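(* A pure quaternion $c$ is in the spherical Mandelbrot set $\mathcal{M}_{\mathrm{Im}\mathbb{H}}$ if and only if $\|Q_c^{(n)}(0)\|\le 2$ for all $n\in\mathbb{N}$.
   Context: $\mathrm{Im}\,\mathbb{H}=\{ai+bj+ck : a,b,c\in\mathbb{R}\}$ is the set of pure quaternions, with Euclidean norm $\|ai+bj+ck\|=\sqrt{a^2+b^2+c^2}$. Unique spherical representation: every $q\in\mathrm{Im}\,\mathbb{H}$ is written $q=\rho(i\sin\phi\cos\theta+j\sin\phi\sin\theta+k\cos\phi)$ with $\rho=\|q\|\ge 0$, $0\le\theta<2\pi$, $0\le\phi\le\pi$; the triple $(\rho,\theta,\phi)$ is made unique by the conventions: for $q=0$ take $\theta=\phi=0$; for $q=ck$ with $c>0$ take $(c,0,0)$; for $q=ck$ with $c<0$ take $(|c|,0,\pi)$. Spherical power: $sp_n(q):=\rho^n\left(i\sin(n\phi)\cos(n\theta)+j\sin(n\phi)\sin(n\theta)+k\cos(n\phi)\right)$, where $(\rho,\theta,\phi)$ is the unique spherical representation of $q$. For $c\in\mathrm{Im}\,\mathbb{H}$ let $Q_c(q)=sp_2(q)+c$ for $q\in\mathrm{Im}\,\mathbb{H}$, and let $Q_c^{(n)}$ be its $n$-fold composition. The spherical Mandelbrot set is $\mathcal{M}_{\mathrm{Im}\mathbb{H}}:=\{c\in\mathrm{Im}\,\mathbb{H} : \{Q_c^{(n)}(0)\}_{n\in\mathbb{N}}\text{ is bounded}\}$. *)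

(* Defs.v *)
From mathcomp Require Import all_boot all_order all_algebra.
From mathcomp Require Import ring lra.
From mathcomp Require Import all_classical all_reals all_analysis.

Set Implicit Arguments.
Unset Strict Implicit.
Unset Printing Implicit Defensive.

Import Order.TTheory GRing.Theory Num.Theory.
Local Open Scope ring_scope.

(* Pure quaternions are represented by their coordinates (a, b, c) in the
   basis i, j, k; row vectors provide the real vector space structure. *)
Notation ImH R := 'rV[R]_3.

Definition pureq (R : realType) (a b c : R) : ImH R :=
  \row_(l < 3) [:: a; b; c]`_l.

(* The norm that MathComp-Analysis puts on row vectors is the sup norm, hence
   an explicit Euclidean norm. *)
Definition qnorm (R : realType) (q : ImH R) : R :=
  Num.sqrt (\sum_(l < 3) (q ord0 l) ^+ 2).

Definition sph_point (R : realType) (rho theta phi : R) : ImH R :=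
  rho *: pureq (sin phi * cos theta) (sin phi * sin theta) (cos phi).

(* The last three clauses are the conventions for the points of the k-axis,
   where theta (and, at 0, phi) is otherwise not determined. *)
Definition is_sph_rep (R : realType) (q : ImH R) (t : R * R * R) : Prop :=
  let: (rho, theta, phi) := t in
  [/\ rho = qnorm q /\ q = sph_point rho theta phi,
      0 <= theta < 2 * pi /\ 0 <= phi <= pi,
      q = 0 -> theta = 0 /\ phi = 0,
      forall c : R, 0 < c -> q = pureq 0 0 c -> t = (c, 0, 0)
    & forall c : R, c < 0 -> q = pureq 0 0 c -> t = (`|c|, 0, pi)].

(* By [sph_rep_exists_unique] below, the default value (0, 0, 0) plays no
   role. *)
Definition sph_rep (R : realType) (q : ImH R) : R * R * R :=
  xget (0, 0, 0) [set t | is_sph_rep q t]%classic.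

Definition sp (R : realType) (n : nat) (q : ImH R) : ImH R :=
  let: (rho, theta, phi) := sph_rep q in
  rho ^+ n *: pureq (sin (n%:R * phi) * cos (n%:R * theta))
                    (sin (n%:R * phi) * sin (n%:R * theta))
                    (cos (n%:R * phi)).

Definition Q (R : realType) (c q : ImH R) : ImH R := sp 2 q + c.

Definition qbounded (R : realType) (u : nat -> ImH R) : Prop :=
  exists M : R, forall n : nat, qnorm (u n) <= M.

Definition spherical_mandelbrot (R : realType) : set (ImH R) :=
  [set c | qbounded (fun n => iter n (Q c) 0)]%classic.

Lemma pureq_inj (R : realType) (a b c a' b' c' : R) :
  pureq a b c = pureq a' b' c' -> [/\ a = a', b = b' & c = c'].
Proof.
move=> /rowP e; split.
- by have := e (inord 0); rewrite !mxE !inordK.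
- by have := e (inord 1); rewrite !mxE !inordK.
- by have := e (inord 2); rewrite !mxE !inordK.
Qed.

Lemma pureqP (R : realType) (q : ImH R) : exists a b c, q = pureq a b c.
Proof.
exists (q ord0 (inord 0)), (q ord0 (inord 1)), (q ord0 (inord 2)).
apply/rowP => -[[|[|[|//]]] h]; rewrite mxE /=; congr (q _ _);
  by apply/val_inj; rewrite /= inordK.
Qed.

Lemma qnorm_pureq (R : realType) (a b c : R) :
  qnorm (pureq a b c) = Num.sqrt (a ^+ 2 + b ^+ 2 + c ^+ 2).
Proof. by rewrite /qnorm !big_ord_recr big_ord0 /= !mxE /= add0r. Qed.

Lemma pureqZ (R : realType) (r a b c : R) :
  r *: pureq a b c = pureq (r * a) (r * b) (r * c).
Proof. by apply/rowP => -[[|[|[|//]]] h]; rewrite !mxE. Qed.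

Lemma pureq0 (R : realType) : pureq 0 0 0 = 0 :> ImH R.
Proof. by apply/rowP => -[[|[|[|//]]] h]; rewrite !mxE. Qed.

Lemma angle_unique (R : realType) (x y : R) :
  0 <= x < 2 * pi -> 0 <= y < 2 * pi ->
  cos x = cos y -> sin x = sin y -> x = y.
Proof.
have sin_neg (z : R) : pi < z -> z < 2 * pi -> sin z < 0.
  move=> z1 z2; have : 0 < sin (z - pi).
    by apply: sin_gt0_pi; lra.
  by rewrite -[z in sin z < 0](subrK pi) sinDpi; lra.
move=> /andP[x0 x1] /andP[y0 y1] ec es.
have [xp|xp] := leP x pi; have [yp|yp] := leP y pi.
- by apply: cos_inj => //; rewrite in_itv /=; lra.
- have := sin_neg _ yp y1; rewrite -es.
  by have := @sin_ge0_pi R x; rewrite x0 xp => /(_ isT); lra.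
- have := sin_neg _ xp x1; rewrite es.
  by have := @sin_ge0_pi R y; rewrite y0 yp => /(_ isT); lra.
- apply: (@addIr _ (- pi)); apply: cos_inj; rewrite ?in_itv /=; [lra|lra|].
  by apply: oppr_inj; rewrite -!cosDpi !subrK.
Qed.

Lemma angle_exists (R : realType) (x y : R) : x ^+ 2 + y ^+ 2 = 1 ->
  exists2 t : R, 0 <= t < 2 * pi & cos t = x /\ sin t = y.
Proof.
move=> e; have p0 := pi_gt0 R.
have xB : -1 <= x <= 1.
  by rewrite -ler_norml -(@ler_pXn2r _ 2) ?nnegrE // expr1n real_normK ?num_real //; nra.
have eN : 1 - x ^+ 2 = y ^+ 2 by lra.
have := acos_ge0 xB; have := acos_lepi xB => a1 a0.
have ca : cos (acos x) = x by apply: acosK; rewrite in_itv.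
have sa := sin_acos xB; rewrite eN sqrtr_sqr in sa.
have [y0|y0] := leP 0 y.
  by exists (acos x); [lra|split; rewrite // sa ger0_norm].
have ap : 0 < acos x.
  rewrite lt_def a0 andbT; apply/eqP => h; move: sa.
  by rewrite h sin0 ltr0_norm //; lra.
exists (pi *+ 2 - acos x); first lra.
rewrite addrC cosD2pi sinD2pi cosN sinN ca sa ltr0_norm //.
by rewrite opprK.
Qed.

Lemma sph_rep_exists_unique (R : realType) (q : ImH R) :
  exists! t : R * R * R, is_sph_rep q t.
Proof.
have p0 := pi_gt0 R.
have [a [b [c ->]]] := pureqP q.
pose N := qnorm (pureq a b c).
have N0 : 0 <= N by apply: sqrtr_ge0.
have N2 : N ^+ 2 = a ^+ 2 + b ^+ 2 + c ^+ 2.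
  by rewrite /N qnorm_pureq sqr_sqrtr // !addr_ge0 // sqr_ge0.
have [/eqP ab0|ab0] := eqVneq (a ^+ 2 + b ^+ 2) 0.
  have [a0 b0] : a = 0 /\ b = 0.
    by move: ab0; rewrite paddr_eq0 ?sqr_ge0 // !sqrf_eq0 => /andP[/eqP -> /eqP ->].
  subst a b.
  have Nc : N = `|c|.
    by rewrite /N qnorm_pureq -sqrtr_sqr; congr Num.sqrt; ring.
  have [c0|c0|c0] := ltrgtP c 0.
  - exists (`|c|, 0, pi); split; last first.
      by move=> [[? ?] ?] [_ _ _ _ h]; rewrite (h c).
    split=> //.
    + split=> //; rewrite /sph_point pureqZ sinpi cospi.
      by rewrite ltr0_norm //; congr pureq; ring.
    + by split; lra.
    + by rewrite -pureq0 => /pureq_inj[_ _ ce]; exfalso; lra.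
    + by move=> d d0 /pureq_inj[_ _ ce]; exfalso; lra.
    + by move=> d d0 /pureq_inj[_ _ ->].
  - exists (c, 0, 0); split; last first.
      by move=> [[? ?] ?] [_ _ _ h _]; rewrite (h c).
    split=> //.
    + rewrite -/N Nc gtr0_norm //; split=> //; rewrite /sph_point pureqZ sin0 cos0.
      by congr pureq; ring.
    + by split; lra.
    + by move=> d d0 /pureq_inj[_ _ ->].
    + by move=> d d0 /pureq_inj[_ _ ce]; exfalso; lra.
  - subst c; exists (0, 0, 0); split; last first.
      move=> [[r t] p] [[-> _] _ h _ _]; rewrite -/N Nc normr0.
      by have [-> ->] := h (pureq0 R).
    split=> //.
    + by rewrite -/N Nc normr0 /sph_point scale0r pureq0.
    + by split; lra.
    + by move=> d d0 /pureq_inj[_ _ ce]; exfalso; lra.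
    + by move=> d d0 /pureq_inj[_ _ ce]; exfalso; lra.
have s0 : 0 < a ^+ 2 + b ^+ 2 by rewrite lt_def ab0 addr_ge0 ?sqr_ge0.
set s := Num.sqrt (a ^+ 2 + b ^+ 2).
have sp : 0 < s by rewrite sqrtr_gt0.
have s2 : s ^+ 2 = a ^+ 2 + b ^+ 2 by rewrite sqr_sqrtr // ltW.
have Np : 0 < N.
  by rewrite lt_def N0 andbT; apply/eqP => h; move: N2; rewrite h; have := sqr_ge0 c; lra.
have off_axis d : pureq a b c <> pureq 0 0 d.
  by move=> /pureq_inj[a0 b0 _]; move: s0; rewrite a0 b0; lra.
have cB : -1 <= c / N <= 1.
  by rewrite ler_pdivlMr // ler_pdivrMr // mulN1r mul1r; apply/andP; split; nra.
have [t tB [ct st]] : exists2 t : R, 0 <= t < 2 * pi & cos t = a / s /\ sin t = b / s.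
  apply: angle_exists; rewrite !expr_div_n -mulrDl -s2 divff //.
  by rewrite expf_neq0 // gt_eqF.
have cp : cos (acos (c / N)) = c / N by apply: acosK; rewrite in_itv.
have sinp : sin (acos (c / N)) = s / N.
  rewrite sin_acos //; have -> : 1 - (c / N) ^+ 2 = (s / N) ^+ 2.
    rewrite !expr_div_n s2; have -> : a ^+ 2 + b ^+ 2 = N ^+ 2 - c ^+ 2 by lra.
    by field; rewrite gt_eqF.
  by rewrite sqrtr_sqr ger0_norm // divr_ge0 // ltW.
exists (N, t, acos (c / N)); split.
  split.
  - split=> //; rewrite /sph_point pureqZ cp sinp ct st.
    by congr pureq; field; rewrite ?gt_eqF.
  - by split=> //; rewrite acos_ge0 ?acos_lepi.
  - by rewrite -pureq0 => /off_axis.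
  - by move=> d _ /off_axis.
  - by move=> d _ /off_axis.
move=> [[r t'] p'] [[-> e] [tB' pB'] _ _ _]; rewrite -/N in e *.
move: e; rewrite /sph_point pureqZ => /pureq_inj[ea eb ec].
have pe : acos (c / N) = p'.
  by rewrite ec mulrC mulKf ?gt_eqF // cosK // in_itv.
rewrite -pe in ea eb *; congr (_, _, _).
rewrite sinp in ea eb; apply: angle_unique => //.
- by rewrite ct ea; field; rewrite ?gt_eqF.
- by rewrite st eb; field; rewrite ?gt_eqF.
Qed.

(* Main.v *)
Require Import Defs.
From mathcomp Require Import all_boot all_order all_algebra.
From mathcomp Require Import ring lra.
From mathcomp Require Import all_classical all_reals all_analysis.

Import Order.TTheory GRing.Theory Num.Theory.
Local Open Scope ring_scope.

(** The spherical square satisfies [qnorm (sp 2 q) = qnorm q ^+ 2], so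
    [qnorm (Q c q) >= qnorm q ^+ 2 - qnorm c] and the classical escape argument
    applies: once an iterate has norm [r > 2] with [r >= qnorm c], each further
    step increases the norm by at least [r * (r - 2) > 0].  If [qnorm c > 2],
    the first iterate [c] itself is such a point. *)

Lemma qnorm_ge0 {R : realType} (q : ImH R) : 0 <= qnorm q.
Proof. exact: sqrtr_ge0. Qed.

Lemma qnorm0 {R : realType} : qnorm (0 : ImH R) = 0.
Proof. by rewrite /qnorm big1 ?sqrtr0 // => l _; rewrite mxE expr0n. Qed.

Lemma qnormN {R : realType} (q : ImH R) : qnorm (- q) = qnorm q.
Proof. by congr Num.sqrt; apply: eq_bigr => l _; rewrite mxE sqrrN. Qed.

Lemma pureqD {R : realType} (a b c a' b' c' : R) :
  pureq a b c + pureq a' b' c' = pureq (a + a') (b + b') (c + c').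
Proof. by apply/rowP => -[[|[|[|//]]] h]; rewrite !mxE. Qed.

Lemma qnorm_pureq_sqr {R : realType} (a b c : R) :
  qnorm (pureq a b c) ^+ 2 = a ^+ 2 + b ^+ 2 + c ^+ 2.
Proof. by rewrite qnorm_pureq sqr_sqrtr // !addr_ge0 // sqr_ge0. Qed.

Lemma cauchy_schwarz_pureq {R : realType} (a b c a' b' c' : R) :
  a * a' + b * b' + c * c' <= qnorm (pureq a b c) * qnorm (pureq a' b' c').
Proof.
apply: le_trans (ler_norm _) _.
rewrite -(@ler_pXn2r _ 2) ?nnegrE ?mulr_ge0 ?qnorm_ge0 //.
rewrite real_normK ?num_real // exprMn !qnorm_pureq_sqr -subr_ge0.
(* Lagrange's identity: the defect in Cauchy-Schwarz is the squared norm of the cross product. *)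
rewrite (_ : _ - _ = (a * b' - b * a') ^+ 2 + (a * c' - c * a') ^+ 2
  + (b * c' - c * b') ^+ 2); last by ring.
by rewrite !addr_ge0 ?sqr_ge0.
Qed.

Lemma ler_qnormD {R : realType} (p q : ImH R) :
  qnorm (p + q) <= qnorm p + qnorm q.
Proof.
have [a [b [c ->]]] := pureqP p; have [a' [b' [c' ->]]] := pureqP q.
rewrite -(@ler_pXn2r _ 2) ?nnegrE ?addr_ge0 ?qnorm_ge0 //.
rewrite sqrrD pureqD !qnorm_pureq_sqr.
have := cauchy_schwarz_pureq a b c a' b' c'.
by lra.
Qed.

Lemma lerB_qnormD {R : realType} (p q : ImH R) :
  qnorm p - qnorm q <= qnorm (p + q).
Proof.
by have := ler_qnormD (p + q) (- q); rewrite addrK qnormN lerBlDr.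
Qed.

(** The angles range over all reals, so this also covers the multiplied angles in [sp], which may
    leave the ranges of the unique representation. *)
Lemma qnorm_sph_point {R : realType} (rho theta phi : R) :
  0 <= rho -> qnorm (sph_point rho theta phi) = rho.
Proof.
move=> rho0; rewrite /sph_point pureqZ qnorm_pureq.
rewrite -[RHS]ger0_norm // -sqrtr_sqr; congr Num.sqrt.
rewrite !exprMn -!mulrDr -[RHS]mulr1 -(cos2Dsin2 phi); congr (_ * _).
by rewrite (cos2Dsin2 theta) mulr1 addrC.
Qed.

Lemma sph_repP {R : realType} (q : ImH R) : is_sph_rep q (sph_rep q).
Proof.
have [t [ht _]] := sph_rep_exists_unique q.
exact: (@xgetPex _ (0, 0, 0) [set t | is_sph_rep q t]%classic
  (ex_intro _ t ht)).
Qed.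

Lemma qnorm_sp {R : realType} (n : nat) (q : ImH R) :
  qnorm (sp n q) = qnorm q ^+ n.
Proof.
rewrite /sp; have := sph_repP q.
case: (sph_rep q) => -[rho theta phi] [[-> _] _ _ _ _].
by apply: qnorm_sph_point; rewrite exprn_ge0 ?qnorm_ge0.
Qed.

Lemma qnorm_Q_ge {R : realType} (c q : ImH R) :
  qnorm q ^+ 2 - qnorm c <= qnorm (Q c q).
Proof. by rewrite -(qnorm_sp 2) lerB_qnormD. Qed.

Lemma qnorm_iter_Q_ge {R : realType} (c q : ImH R) (k : nat) :
  2 < qnorm q -> qnorm c <= qnorm q ->
  qnorm q + k%:R * (qnorm q * (qnorm q - 2)) <= qnorm (iter k (Q c) q).
Proof.
set r := qnorm q => r2 cr; elim: k => [|k IH]; first by rewrite mul0r addr0.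
have rk : r <= qnorm (iter k (Q c) q).
  by apply: le_trans IH; rewrite lerDl !mulr_ge0 ?ler0n //; lra.
(* With [s] the norm of the [k]-th iterate, [s ^+ 2 - r >= s + r * (r - 2)] amounts to
   [(s - r) * (s + r - 1) >= 0]. *)
have := qnorm_Q_ge c (iter k (Q c) q); rewrite -iterS mulrSr.
by nra.
Qed.

(** Linear growth with slope [d > 0] exceeds any bound by the Archimedean property. The free
    starting point [q] allows use on a tail of the orbit of 0. *)
Lemma escape {R : realType} (c q : ImH R) :
  2 < qnorm q -> qnorm c <= qnorm q ->
  ~ qbounded (fun k => iter k (Q c) q).
Proof.
move=> q2 cq [M hM].
set d := qnorm q * (qnorm q - 2); have d0 : 0 < d by rewrite mulr_gt0; lra.
have := le_trans (qnorm_iter_Q_ge c q (Num.bound (M / d)) q2 cq) (hM _).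
have : M < (Num.bound (M / d))%:R * d.
  rewrite -ltr_pdivrMr // archi_boundP // divr_ge0 ?(ltW d0) //.
  (* [M] is nonnegative because it bounds a norm. *)
  exact: le_trans (qnorm_ge0 _) (hM 0%N).
by rewrite -/d; lra.
Qed.

Theorem theorem10 (R : realType) (c : ImH R) :
  spherical_mandelbrot c <-> forall n : nat, qnorm (iter n (Q c) 0) <= 2.
Proof.
split=> [[M hM] n|h]; last by exists 2.
have bnd m : qbounded (fun k => iter k (Q c) (iter m (Q c) 0)).
  by exists M => k; rewrite -iterD.
have [//|un2] := leP (qnorm (iter n (Q c) 0)) 2; exfalso.
(* Escape starts from a point at least as large as [c]: the [n]-th iterate if [qnorm c <= 2], the
   first one otherwise. *)
have [c2|c2] := leP (qnorm c) 2.
  by apply: escape (bnd n) => //; apply: le_trans c2 (ltW un2).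
have u1 : qnorm c <= qnorm (iter 1 (Q c) 0).
  (* The first iterate is [sp 2 0 + c], and [sp 2 0] has norm 0. *)
  have := lerB_qnormD c (sp 2 0).
  by rewrite qnorm_sp qnorm0 expr0n subr0 addrC.
by apply: escape (bnd 1%N) => //; apply: lt_le_trans u1.
Qed.
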